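(* Let $r\geq 0$ and assume the ground ring $R$ is nonzero. The $E^r$-page of the magnitude-path spectral sequence distinguishes all of the directed cycles $Z_m$ for $m\geq r$, i.e. if $m,n\geq 1$ are distinct and $m,n\geq r$, then $E^r_{*,*}(Z_m)$ and $E^r_{*,*}(Z_n)$ are not isomorphic as bigraded $R$-modules; and $E^r_{*,*}(Z_m)$ is trivial (a single copy of $R$ in bidegree $(0,0)$) for $1\leq m\leq r$. In particular, bigraded path homology distinguishes all the directed cycles $Z_m$ for $m\geq 2$.
   Context: Fix a commutative ground ring $R$. A directed graph $G$ has a vertex set $V(G)$ and edge set $E(G)\subseteq V(G)\times V(G)$. The distance $d(x,y)\in\{0,1,\dots,\infty\}$ is the minimal number of edges in a directed path from $x$ to $y$. The directed cycle $Z_m$ ($m\geq1$) has $m$ cyclically ordered vertices and a single directed edge between adjacent vertices, consistently oriented (edges $x\to x+1$ for $x\in\mathbb Z/m$); $Z_1$ is a single vertex. The reachability complex $\mathrm{RC}_*(G)$ has in degree $k$ the free $R$-module on tuples $(x_0,\dots,x_k)$ of vertices with consecutive entries distinct and $d(x_i,x_{i+1})<\infty$ for all $i$; its differential is $\sum_{i=0}^k(-1)^i(x_0,\dots,\widehat{x_i},\dots,x_k)$, omitting terms with repeated consecutive entries. The length of a tuple is $\ell(x_0,\dots,x_k)=\sum_i d(x_i,x_{i+1})$, and $F_\ell\mathrm{RC}_*(G)$ is spanned by tuples of length at most $\ell$. The magnitude-path spectral sequence $\{E^r_{*,*}(G),d^r\}_{r\geq0}$ is the spectral sequence of this filtered complex,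 with $E^0_{i,j}(G)=F_i\mathrm{RC}_{i+j}(G)/F_{i-1}\mathrm{RC}_{i+j}(G)$ and $d^r$ of bidegree $(-r,r-1)$. Bigraded path homology is $\mathrm{PH}_{k,\ell}(G)=E^2_{\ell,k-\ell}(G)$. *)

(* Defs.v *)
From HB Require Import structures.
From mathcomp Require Import all_boot all_order all_algebra.
From mathcomp Require Import boolp.
From mathcomp Require Import finmap.
From mathcomp.multinomials Require Import monalg.

Set Implicit Arguments.
Unset Strict Implicit.
Unset Printing Implicit Defensive.

Import Order.TTheory GRing.Theory Num.Theory.
Local Open Scope ring_scope.
Local Open Scope quotient_scope.

(* The R-module Z / (Z :&: B), for submodules Z and B of an R-module C; it is
   Z / B as soon as B is contained in Z. *)
Section Subquotient.
Variables (R : comNzRingType) (C : lmodType R) (Z B : submodClosed C).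

Definition submod := {x : C | x \in Z}.
HB.instance Definition _ := SubType.on submod.
HB.instance Definition _ := Choice.on submod.
HB.instance Definition _ := [SubChoice_isSubLmodule of submod by <:].

Definition submod_mem : {pred submod} := [pred x | val x \in B].

Lemma submod_mem_closed : submod_closed submod_mem.
Proof.
split=> [|a x y]; rewrite !inE; first by rewrite raddf0 rpred0.
by move=> Bx By; rewrite linearP rpredD ?rpredZ.
Qed.
HB.instance Definition _ := GRing.isSubmodClosed.Build R submod submod_mem
  submod_mem_closed.

Definition subquot := Quotient.quot submod_mem.
HB.instance Definition _ := EqQuotient.on subquot.
HB.instance Definition _ := GRing.Zmodule.on subquot.

Definition subquot_scale (a : R) (q : subquot) : subquot :=
  \pi_subquot (a *: repr q).

Lemma pi_scale a (x : submod) :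
  subquot_scale a (\pi_subquot x) = \pi_subquot (a *: x).
Proof.
rewrite /subquot_scale; apply/eqP.
rewrite -(Quotient.idealrBE submod_mem) -scalerBr rpredZ //.
by rewrite Quotient.idealrBE reprK; apply: eqxx.
Qed.

Lemma subquot_scaleA a b q :
  subquot_scale a (subquot_scale b q) = subquot_scale (a * b) q.
Proof. by elim/quotW: q => x; rewrite (pi_scale b x) !pi_scale scalerA. Qed.

Lemma subquot_scale1 : left_id 1 subquot_scale.
Proof. by elim/quotW=> x; rewrite pi_scale scale1r. Qed.

Lemma pi_addE (x y : submod) :
  \pi_subquot (x + y) = \pi_subquot x + \pi_subquot y.
Proof. by rewrite Quotient.pi_add. Qed.

Lemma subquot_scaleDr : right_distributive subquot_scale +%R.
Proof.
move=> a; elim/quotW=> x; elim/quotW=> y.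
by rewrite -pi_addE !pi_scale scalerDr pi_addE.
Qed.

Lemma subquot_scaleDl q : {morph subquot_scale^~ q : a b / a + b}.
Proof. by elim/quotW: q => x a b; rewrite !pi_scale scalerDl pi_addE. Qed.

HB.instance Definition _ := GRing.Zmodule_isLmodule.Build R subquot
  subquot_scaleA subquot_scale1 subquot_scaleDr subquot_scaleDl.

End Subquotient.

Record digraph := Digraph { vertex :> choiceType; edge : rel vertex }.

(* Z_m on the vertices 0, ..., m - 1; the guard 1 < m excludes a loop on Z_1. *)
Definition dcycle (m : nat) : digraph :=
  @Digraph 'I_m (fun x y => (1 < m)%N && (y == ordS x)).

Section Distance.
Variable G : digraph.

(* x :: p is a directed path from x to y with n edges. *)
Definition dpath (x y : G) (n : nat) : Prop :=
  exists p : seq G, [/\ size p = n, path (@edge G) x p & last x p = y].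

(* None stands for infinity. *)
Definition dist (x y : G) : option nat :=
  if pselect (exists n, `[< dpath x y n >]) is left xy
  then Some (ex_minn xy) else None.

Definition step (x y : G) : bool := (x != y) && isSome (dist x y).

Definition is_gen (s : seq G) : bool := (s != [::]) && sorted step s.

(* The tuples (x_0, ..., x_k) spanning the reachability complex, for all k. *)
Definition gen := {s : seq G | is_gen s}.
HB.instance Definition _ := SubType.on gen.
HB.instance Definition _ := Choice.on gen.

Definition len (s : seq G) : nat :=
  if s is x :: s' then sumn (pairmap (fun y z => odflt 0%N (dist y z)) x s')
  else 0%N.

End Distance.

(* {malg R[K]} is the free R-module on K; ext f extends f linearly to it. It is
   locked, for otherwise failing unifications unfold it and do not terminate in
   practice. *)
HB.lock Definition ext (R : comNzRingType) (K : choiceType) (M : lmodType R)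
    (f : K -> M) (c : {malg R[K]}) : M :=
  \sum_(k <- msupp c) c@_k *: f k.

Section LinearExtension.
Variables (R : comNzRingType) (K : choiceType) (M : lmodType R) (f : K -> M).

Lemma extEw (c : {malg R[K]}) (d : {fset K}) :
  (msupp c `<=` d)%fset -> ext f c = \sum_(k <- d) c@_k *: f k.
Proof.
rewrite ext.unlock => cd; apply: big_fset_incl => // k _ kc.
by rewrite mcoeff_outdom // scale0r.
Qed.

Lemma ext_is_linear : linear (ext f).
Proof.
move=> a x y; pose d := (msupp (a *: x + y) `|` msupp x `|` msupp y)%fset.
rewrite !(@extEw _ d);
  try by apply/fsubsetP => k; rewrite !inE => ->; rewrite ?orbT.
rewrite scaler_sumr -big_split; apply: eq_bigr => k _ /=.
by rewrite mcoeffD mcoeffZ scalerDl scalerA.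
Qed.
HB.instance Definition _ := GRing.isLinear.Build R {malg R[K]} M *:%R (ext f)
  ext_is_linear.

End LinearExtension.

(* The chains of all degrees together, i.e. the direct sum of the RC_k(G), form
   the free module {malg R[gen G]}. *)
Section ReachabilityComplex.
Variables (R : comNzRingType) (G : digraph).

Local Notation RC := {malg R[gen G]}.

(* Reachability is transitive, so deleting an entry of a generator of degree
   k > 0 fails to give a generator only if it creates a repetition. A generator
   of degree 0 has no face. *)
Definition face (s : seq G) (i : nat) : RC :=
  if insub (take i s ++ drop i.+1 s) is Some t then << t >> else 0.

Definition bd_gen (t : gen G) : RC :=
  \sum_(i < size (val t)) (-1) ^+ i *: face (val t) i.

Definition bd : RC -> RC := ext bd_gen.
HB.instance Definition _ := GRing.Linear.on bd.

(* F_i RC_n *)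
Definition filt (i n : int) : {pred RC} :=
  [pred c : RC | all (fun t : gen G =>
     ((size (val t))%:Z == n + 1) && ((len (val t))%:Z <= i)) (msupp c)].

Lemma filt_closed i n : submod_closed (filt i n).
Proof.
split=> [|a x y]; rewrite !inE; first by rewrite msupp0.
move=> /allP Fx /allP Fy; apply/allP=> t /(fsubsetP (msuppD_le _ _)).
by rewrite inE => /orP[/(fsubsetP (msuppZ_le _ _))/Fx|/Fy].
Qed.
HB.instance Definition _ i n := GRing.isSubmodClosed.Build R RC (filt i n)
  (filt_closed i n).

(* The pages are given by the usual closed formula
     E^r_{i,j} = Z^r_i / (Z^{r-1}_{i-1} + d Z^{r-1}_{i+r-1})
   with Z^r_i = { c in F_i RC_{i+j} | d c in F_{i-r} }. For r = 0 the
   denominator is F_{i-1} since d preserves the filtration, so that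
   E^0_{i,j} = F_i RC_{i+j} / F_{i-1} RC_{i+j}. *)
Definition cyc (r i n : int) : {pred RC} :=
  [pred c | (c \in filt i n) && (bd c \in filt (i - r) (n - 1))].

Lemma cyc_closed r i n : submod_closed (cyc r i n).
Proof.
split=> [|a x y]; first by apply/andP; rewrite linear0 !rpred0.
have [_ L] := filt_closed i n; have [_ Lb] := filt_closed (i - r) (n - 1).
move=> /andP[Fx Fbx] /andP[Fy Fby]; apply/andP; split; first exact: L Fx Fy.
have -> : bd (a *: x + y) = a *: bd x + bd y by exact: linearP.
exact: Lb Fbx Fby.
Qed.
HB.instance Definition _ r i n := GRing.isSubmodClosed.Build R RC (cyc r i n)
  (cyc_closed r i n).

Definition bnd (r i n : int) : {pred RC} :=
  [pred c | `[< exists c1 c2 : RC,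
     [/\ c1 \in cyc (r - 1) (i - 1) n,
         c2 \in cyc (r - 1) (i + r - 1) (n + 1) & c = c1 + bd c2] >]].

Lemma bnd_closed r i n : submod_closed (bnd r i n).
Proof.
split=> [|a x y].
  by apply/asboolP; exists 0, 0; rewrite !rpred0 linear0 addr0.
move=> /asboolP[x1 [x2 [Zx1 Zx2 ->]]] /asboolP[y1 [y2 [Zy1 Zy2 ->]]].
have [_ L1] := cyc_closed (r - 1) (i - 1) n.
have [_ L2] := cyc_closed (r - 1) (i + r - 1) (n + 1).
apply/asboolP; exists (a *: x1 + y1), (a *: x2 + y2).
split; [exact: L1 Zx1 Zy1 | exact: L2 Zx2 Zy2 |].
have -> : bd (a *: x2 + y2) = a *: bd x2 + bd y2 by exact: linearP.
by rewrite scalerDr addrACA.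
Qed.
HB.instance Definition _ r i n := GRing.isSubmodClosed.Build R RC (bnd r i n)
  (bnd_closed r i n).

End ReachabilityComplex.

Definition bigraded (R : comNzRingType) := int -> int -> lmodType R.

Definition bigraded_iso (R : comNzRingType) (A B : bigraded R) : Prop :=
  exists f : forall i j, {linear A i j -> B i j}, forall i j, bijective (f i j).

Definition mpss (R : comNzRingType) (G : digraph) (r : nat) : bigraded R :=
  fun i j => subquot (cyc (R := R) (G := G) r%:Z i (i + j)) (bnd r%:Z i (i + j)).

Definition PH (R : comNzRingType) (G : digraph) : bigraded R :=
  fun k l => mpss R G 2%N l (k - l).

(* R in bidegree (0, 0), and zero in all other bidegrees. *)
Definition trivial_bigraded (R : comNzRingType) : bigraded R :=
  fun i j => if (i == 0) && (j == 0) then (R^o : lmodType R)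
             else ('rV[R]_0 : lmodType R).

(* Main.v *)
(* In Z_m every vertex is reachable from every other, so RC(Z_m) is the
   normalized chain complex of a full simplex. Coning off a vertex contracts it
   and raises lengths by at most m - 1; for m <= r the contraction therefore
   kills E^r outside bidegree (0, 0), where the augmentation identifies it
   with R.

   Let m < n and 1 <= r <= m. The two pages differ in total degree 2 and
   filtration n. In Z_m a triple (x, y, z) of length n > m equals the boundary
   of (x, y, x, z) up to shorter tuples, so E^r(Z_m) vanishes there. In Z_n the
   cone c from 0 over the fundamental cycle z = sum_y (y, y + 1) has boundary z,
   of length 1 <= n - r, and the cocycle counting how often a triple winds
   around Z_n is 1 on c but vanishes on triples of length less than n. For
   r = 0, the pair (0, n - 1) is longer than every pair in Z_m. *)
Require Import Defs.
From HB Require Import structures.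
From mathcomp Require Import all_boot all_order all_algebra.
From mathcomp Require Import boolp finmap zify.
From mathcomp.multinomials Require Import monalg.

Set Implicit Arguments.
Unset Strict Implicit.
Unset Printing Implicit Defensive.

Import Order.TTheory GRing.Theory Num.Theory.
Local Open Scope ring_scope.
Local Open Scope quotient_scope.

(** * Subquotients of a module *)

Section Subquotients.
Variables (R : comNzRingType) (C : lmodType R) (Z B : submodClosed C).
Local Notation Q := (subquot Z B).

Lemma subquot_piE (x y : submod Z) :
  (\pi_Q x == \pi_Q y) = (val x - val y \in B).
Proof. by rewrite -(Quotient.idealrBE (submod_mem (Z:=Z) B)) inE raddfB. Qed.

Lemma subquot_pi_eq0 (x : submod Z) : (\pi_Q x == 0) = (val x \in B).
Proof.
have -> : 0 = \pi_Q 0 by apply: (addrI (\pi_Q 0)); rewrite -pi_addE !addr0.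
by rewrite subquot_piE -raddfB subr0.
Qed.

Lemma subquot_eq0 : {subset Z <= B} -> forall q : Q, q = 0.
Proof.
by move=> ZB; elim/quotW=> x; apply/eqP; rewrite subquot_pi_eq0 ZB ?(valP x).
Qed.

Lemma subquot_neq0 x : x \in Z -> x \notin B -> exists q : Q, q <> 0.
Proof.
move=> Zx Bx; exists (\pi_Q (Sub x Zx)); apply/eqP.
by rewrite subquot_pi_eq0 SubK.
Qed.

(** Two representatives of a class differ by an element of both [Z] and [B], where [phi] is zero, so
    any representative may be used. *)
Lemma subquot_lift (M : lmodType R) (phi : {linear C -> M}) :
    (forall x, x \in Z -> x \in B -> phi x = 0) ->
  exists f : {linear Q -> M}, forall x, f (\pi_Q x) = phi (val x).
Proof.
move=> phi0; pose f (q : Q) := phi (val (repr q)).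
have fpi x : f (\pi_Q x) = phi (val x).
  apply/eqP; rewrite -subr_eq0 /f -(raddfB phi); apply/eqP/phi0.
    by rewrite -raddfB; apply: valP.
  by rewrite -subquot_piE reprK.
have lf : linear f.
  move=> a; elim/quotW=> x; elim/quotW=> y.
  rewrite [a *: _](pi_scale B a x) -pi_addE !fpi.
  by rewrite !linearP.
pose F := GRing.isLinear.Build _ _ _ _ f lf.
exists (HB.pack_for {linear Q -> M} f F) => x; exact: fpi.
Qed.

End Subquotients.

(** * Linear maps out of a free module *)

Section FreeModules.
Variables (R : comNzRingType) (K : choiceType) (M : lmodType R).

Lemma extU (f : K -> M) k : ext f << k >> = f k.
Proof.
rewrite (@extEw _ _ _ f _ [fset k]%fset) ?msuppU_le //.
by rewrite big_seq_fset1 mcoeffUU scale1r.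
Qed.

Lemma eq_ext (f g : K -> M) c : {in msupp c, f =1 g} -> ext f c = ext g c.
Proof.
move=> fg; rewrite !(extEw _ (fsubset_refl _)).
by apply: eq_big_seq => k /fg ->.
Qed.

Lemma ext_basis (c : {malg R[K]}) : ext (fun k => << k >> : {malg R[K]}) c = c.
Proof.
rewrite (extEw _ (fsubset_refl _)) [RHS]monalgE; apply: eq_bigr => k _.
by apply/malgP=> l; rewrite mcoeffZ !mcoeffU mulr_natr.
Qed.

Lemma linear_ext (phi : {linear {malg R[K]} -> M}) c :
  phi c = ext (fun k => phi << k >>) c.
Proof.
rewrite -{1}(ext_basis c) !(extEw _ (fsubset_refl _)) linear_sum.
by apply: eq_bigr => k _; rewrite linearZ.
Qed.

Lemma linear_eq (phi psi : {linear {malg R[K]} -> M}) c :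
  {in msupp c, forall k, phi << k >> = psi << k >>} -> phi c = psi c.
Proof.
by move=> e; rewrite (linear_ext phi) (linear_ext psi); apply: eq_ext.
Qed.

End FreeModules.

(** * Tuples as chains, and the filtration *)

Section Chains.
Variables (R : comNzRingType) (G : digraph).
Local Notation RC := {malg R[gen G]}.

(** Tuples that are not generators become 0, as in a normalized complex, so boundary formulas need
    no case distinction on repetitions. *)
Definition tup (s : seq G) : RC := if insub s is Some t then << t >> else 0.

Lemma tup_val (t : gen G) : tup (val t) = << t >>.
Proof. by rewrite /tup valK. Qed.

Lemma tup0 s : ~~ is_gen s -> tup s = 0.
Proof. by move=> s0; rewrite /tup insubN. Qed.

Lemma ext_tup (M : lmodType R) (f : seq G -> M) s :
  ext (fun t : gen G => f (val t)) (tup s) = if is_gen s then f s else 0.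
Proof.
case: ifP => gs; last by rewrite tup0 ?gs // linear0.
by rewrite -[s]/(val (Sub s gs : gen G)) tup_val extU.
Qed.

Lemma bd_tup s : is_gen s ->
  bd (tup s) = \sum_(i < size s) (-1) ^+ i *: tup (take i s ++ drop i.+1 s).
Proof.
by move=> gs; rewrite -[s]/(val (Sub s gs : gen G)) tup_val /bd extU.
Qed.

Lemma filtP i n (c : RC) :
  reflect {in msupp c, forall t : gen G,
             (size (val t))%:Z = n + 1 /\ (len (val t))%:Z <= i}
          (c \in filt i n).
Proof.
apply: (iffP allP) => F t /F; first by case/andP=> /eqP.
by case=> -> ->; rewrite eqxx.
Qed.

Lemma filt0 i n : (0 : RC) \in filt i n.
Proof. by apply/filtP=> t; rewrite msupp0. Qed.

Lemma filtZD i n a (x y : RC) :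
  x \in filt i n -> y \in filt i n -> a *: x + y \in filt i n.
Proof. by case: (filt_closed R G i n) => _; apply. Qed.

Lemma filtD i n (x y : RC) :
  x \in filt i n -> y \in filt i n -> x + y \in filt i n.
Proof. by move=> Fx Fy; rewrite -[x]scale1r filtZD. Qed.

Lemma filtB i n (x y : RC) :
  x \in filt i n -> y \in filt i n -> x - y \in filt i n.
Proof. by move=> Fx Fy; rewrite addrC -scaleN1r filtZD. Qed.

Lemma filt_ext i n (K : choiceType) (f : K -> RC) c :
  {in msupp c, forall k, f k \in filt i n} -> ext f c \in filt i n.
Proof.
move=> Ff; rewrite (extEw _ (fsubset_refl _)) big_seq.
by elim/big_rec: _ => [|k x kc Fx]; [exact: filt0 | exact: filtZD (Ff k kc) Fx].
Qed.

Lemma filt_tup (i n : int) s :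
  (size s)%:Z = n + 1 -> (is_gen s -> (len s)%:Z <= i) -> tup s \in filt i n.
Proof.
move=> ss si; have [gs|gs] := boolP (is_gen s); last by rewrite tup0 ?filt0.
apply/filtP => t; rewrite -[s]/(val (Sub s gs : gen G)) tup_val.
by move=> /(fsubsetP msuppU_le); rewrite inE => /eqP ->; rewrite SubK si.
Qed.

Lemma filtS i i' n (c : RC) : i <= i' -> c \in filt i n -> c \in filt i' n.
Proof.
by move=> ii /filtP F; apply/filtP => t /F [-> /le_trans]; split => //; auto.
Qed.

Lemma filt_lt0 i n (c : RC) : i < 0 -> c \in filt i n -> c = 0.
Proof.
move=> i0 /filtP F; apply/malgP => t; rewrite mcoeff0; apply: mcoeff_outdom.
by apply/negP => /F [_]; lia.
Qed.

Lemma cycP r i n (c : RC) :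
  reflect (c \in filt i n /\ bd c \in filt (i - r) (n - 1)) (c \in cyc r i n).
Proof. exact: andP. Qed.

Lemma bndP r i n (c : RC) :
  reflect (exists c1 c2, [/\ c1 \in cyc (r - 1) (i - 1) n,
             c2 \in cyc (r - 1) (i + r - 1) (n + 1) & c = c1 + bd c2])
          (c \in bnd r i n).
Proof. exact: asboolP. Qed.

End Chains.

(** * Cones and augmentation in a strongly connected graph *)

(* The hypothesis on step says that the graph is strongly connected. *)
Section StronglyConnected.
Variables (R : comNzRingType) (G : digraph).
Hypothesis connG : forall x y : G, step x y = (x != y).
Local Notation RC := {malg R[gen G]}.
Local Notation tup := (@tup R G).

Lemma is_gen_cons (x y : G) s :
  is_gen (x :: y :: s) = (x != y) && is_gen (y :: s).
Proof. by rewrite /is_gen /= connG. Qed.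

Definition cone_gen (x : G) (t : gen G) : RC := tup (x :: val t).
Definition cone (x : G) : RC -> RC := ext (cone_gen x).
HB.instance Definition _ x := GRing.Linear.on (cone x).

Definition aug_gen (t : gen G) : R^o := (size (val t) == 1%N)%:R.
Definition aug : RC -> R^o := ext aug_gen.
HB.instance Definition _ := GRing.Linear.on aug.

Lemma cone_tup x s : s != [::] -> cone x (tup s) = tup (x :: s).
Proof.
move=> s0; rewrite /cone (ext_tup (fun s => tup (x :: s))).
case: ifP => // gs; rewrite tup0 //.
by case: s s0 gs => // y s _ gs; rewrite is_gen_cons gs andbF.
Qed.

Lemma aug_tup s : aug (tup s) = (size s == 1%N)%:R.
Proof.
rewrite /aug (ext_tup (fun s => (size s == 1%N)%:R : R^o)).
by case: s => [|x [|y s]] //=; case: ifP.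
Qed.

Lemma bd_tup1 x : bd (tup [:: x]) = 0.
Proof. by rewrite bd_tup // big_ord1 /= tup0 ?scaler0. Qed.

(** Deleting [x] leaves [s], and deleting a later entry commutes with coning up to sign. If [s] has
    a single entry, deleting it leaves (x): this is the augmentation term. *)
Lemma bd_tup_cons x s : s != [::] ->
  bd (tup (x :: s)) = tup s - cone x (bd (tup s)) - aug (tup s) *: tup [:: x].
Proof.
have gen_case y u : is_gen (x :: y :: u) ->
    bd (tup (x :: y :: u)) = tup (y :: u) - cone x (bd (tup (y :: u)))
       - aug (tup (y :: u)) *: tup [:: x].
  move=> g; have gy : is_gen (y :: u).
    by move: g; rewrite is_gen_cons => /andP[].
  rewrite bd_tup // big_ord_recl expr0 scale1r drop1 /= -addrA; congr (_ + _).
  case: u g gy => [|z u] g gy.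
    rewrite aug_tup bd_tup1 linear0 oppr0 add0r /= scale1r.
    by rewrite big_ord1 /= expr1 scaleN1r.
  rewrite aug_tup scale0r subr0 [in RHS]bd_tup // linear_sum -sumrN.
  apply: eq_bigr => i _; rewrite linearZ -scaleNr exprS mulN1r; congr (_ *: _).
  by rewrite [RHS]cone_tup //; case: i => [[]].
case: s => // y s _.
have [g|] := boolP (is_gen (x :: y :: s)); first exact: gen_case.
rewrite is_gen_cons negb_and negbK => gxy.
rewrite (@tup0 _ _ (x :: _)) ?is_gen_cons ?negb_and ?negbK // linear0.
have [gy|gy] := boolP (is_gen (y :: s)); last first.
  by rewrite (tup0 R gy) !linear0 scale0r !subr0 !addr0.
move: gxy; rewrite gy orbF => /eqP xy.
case: s gy => [|z s] gy.
  by rewrite aug_tup bd_tup1 linear0 xy scale1r subr0 subrr.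
(* The tail starts with [x], so the left side is 0. On the right, the cone over the first face of
   the tail is the tail itself, and all other cones vanish because coning twice with [x] gives 0. *)
have gz : is_gen (x :: z :: s) by rewrite xy.
have cone_x t : t != [::] -> cone x (cone x (tup t)) = 0.
  by move=> t0; rewrite !cone_tup // tup0 // is_gen_cons eqxx.
have cone2 c : cone x (cone x c) = 0.
  rewrite -(ext_basis c) !(extEw _ (fsubset_refl _)) !linear_sum big1 // => k _.
  rewrite !linearZ /= -tup_val cone_x ?scaler0 //.
  by case: (val k) (valP k).
rewrite -xy gen_case // (aug_tup [:: _, _ & _]) scale0r subr0.
rewrite !linearB linearZ /= cone2 !cone_tup //.
rewrite (@tup0 _ _ [:: x; x]) ?is_gen_cons ?eqxx // scaler0 !oppr0 !addr0.
by rewrite subrr.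
Qed.

(** Extended linearly from tuples: coning with [x] is a contracting homotopy onto the point [x]. *)
Lemma bd_cone x (c : RC) :
  bd (cone x c) = c - cone x (bd c) - aug c *: tup [:: x].
Proof.
pose g c : RC := c - cone x (bd c) - aug c *: tup [:: x].
have lg : linear g.
  move=> a u v; rewrite /g.
  have -> : cone x (bd (a *: u + v)) = a *: cone x (bd u) + cone x (bd v).
    by rewrite (linearP (@bd R G)) (linearP (cone x)).
  have -> : aug (a *: u + v) *: tup [:: x] =
      a *: (aug u *: tup [:: x]) + aug v *: tup [:: x].
    by rewrite (linearP aug) scalerDl scalerA.
  move: (cone x _) (cone x _) (aug u *: _) (aug v *: _) => b' b e' e.
  by rewrite !scalerBr !opprD [_ + _ + (_ - b')]addrACA [LHS]addrACA.
pose lin_g := GRing.isLinear.Build _ _ _ _ g lg.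
pose gL := HB.pack_for {linear RC -> RC} g lin_g.
apply: (linear_eq (phi := @bd R G \o cone x) (psi := gL)) => t _ /=.
rewrite /gL /= /g.
have t0 : val t != [::] by case: (val t) (valP t).
by rewrite -tup_val cone_tup // bd_tup_cons.
Qed.

Lemma aug_cone x (c : RC) : aug (cone x c) = 0.
Proof.
apply: (linear_eq (phi := aug \o cone x) (psi := \0)) => t _ /=.
have t0 : val t != [::] by case: (val t) (valP t).
by rewrite -tup_val cone_tup // aug_tup; case: (val t) t0.
Qed.

Lemma aug_bd (c : RC) : aug (bd c) = 0.
Proof.
apply: (linear_eq (phi := aug \o @bd R G) (psi := \0)) => t _ /=.
rewrite -tup_val; case: (val t) (valP t) => // x [|y s] _.
  by rewrite bd_tup1 linear0.
rewrite -cone_tup // bd_cone !linearB linearZ /= aug_cone subr0.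
by rewrite [aug (tup [:: x])]aug_tup [_ *: _]mulr1 subrr.
Qed.

(** Induction along the tuple with the homotopy formula replaces the usual sign cancellation between
    double faces. *)
Lemma bd_bd (c : RC) : bd (bd c) = 0.
Proof.
apply: (linear_eq (phi := @bd R G \o @bd R G) (psi := \0)) => t _ /=.
rewrite -tup_val; case: (val t) (valP t) => // x s _.
elim: s x => [|y s IH] x; first by rewrite bd_tup1 linear0.
rewrite -cone_tup // bd_cone !linearB linearZ /= bd_tup1 scaler0 subr0.
by rewrite bd_cone IH linear0 aug_bd scale0r !subr0 subrr.
Qed.

End StronglyConnected.

(** * Vanishing in a bidegree, the invariant that tells pages apart *)

Definition vanishes (R : comNzRingType) (A : bigraded R) (i j : int) : Prop :=
  forall a : A i j, a = 0.

Lemma bigraded_iso_vanishes (R : comNzRingType) (A B : bigraded R) i j :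
  bigraded_iso A B -> vanishes A i j <-> vanishes B i j.
Proof.
case=> f /(_ i j) [g fK gK]; split=> [A0 b|B0 a].
  by rewrite -(gK b) (A0 (g b)) linear0.
by apply: (can_inj fK); rewrite linear0; apply: B0.
Qed.

(** * Triviality of the page when all distances from one vertex are below r *)

Section Contraction.
Variables (R : comNzRingType) (G : digraph) (r : nat) (x : G).
Hypothesis connG : forall y z : G, step y z = (y != z).
Hypothesis radius : forall y : G, (odflt 0%N (dist x y) < r)%N.
Local Notation RC := {malg R[gen G]}.

Lemma filt_cone i n (c : RC) :
  c \in filt i n -> cone x c \in filt (i + r%:Z - 1) (n + 1).
Proof.
move=> /filtP Fc; apply: filt_ext => -[s gs] /Fc /= [st lt].
rewrite /cone_gen /=; apply: filt_tup => [|_] /=; first by lia.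
case: s gs st lt => [|y s] //= _ _ lt.
by have := radius y; lia.
Qed.

Lemma filt_pt i (a : R) : 0 <= i -> a *: tup R [:: x] \in filt i 0.
Proof.
move=> i0; rewrite -[_ *: _]addr0 filtZD ?filt0 //.
exact: filt_tup.
Qed.

Lemma bd_pt (a : R) : bd (a *: tup R [:: x]) = 0.
Proof. by rewrite linearZ /= bd_tup1 scaler0. Qed.

(** The homotopy formula writes c as cone (bd c) + (aug c) x + bd (cone c). As [bd c] lies in
    F_{i-r} and coning raises lengths by at most r - 1, the first term is in F_{i-1} and [cone x c]
    in F_{i+r-1}. *)
Lemma cyc_sub_bnd i n (c : RC) :
    c \in cyc r%:Z i n -> aug c *: tup R [:: x] \in filt (i - 1) n ->
  c \in bnd r%:Z i n.
Proof.
move=> /cycP [Fc Fdc] Fa.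
have Fh : cone x (bd c) \in filt (i - 1) n.
  by have := filt_cone Fdc; rewrite !subrK.
apply/bndP; exists (cone x (bd c) + aug c *: tup R [:: x]), (cone x c); split.
- apply/cycP; split; first exact: filtD.
  rewrite linearD /= bd_pt addr0 (bd_cone connG) (bd_bd connG) (aug_bd connG).
  rewrite linear0 scale0r !subr0.
  by have -> : i - 1 - (r%:Z - 1) = i - r%:Z by lia.
- apply/cycP; split; first exact: filt_cone.
  have -> : i + r%:Z - 1 - (r%:Z - 1) = i by lia.
  rewrite addrK (bd_cone connG).
  have le_i : i - 1 <= i by lia.
  by rewrite !filtB // (filtS le_i).
- rewrite (bd_cone connG) -[X in _ + X]addrA -opprD.
  by rewrite addrCA subrr addr0.
Qed.

(** Only the augmentation term needs care: it vanishes if n is nonzero, no chain has negative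
    length, and for n = 0 < i the point, of length 0, lies in F_{i-1}. *)
Lemma cyc_sub_bnd_off0 i n :
  (i != 0) || (n != 0) ->
  {subset cyc (R := R) (G := G) r%:Z i n <= bnd r%:Z i n}.
Proof.
move=> in0 c Zc; apply: cyc_sub_bnd => //; case/cycP: Zc => Fc _.
have [n0|n0] := eqVneq n 0; last first.
  suff -> : aug c = 0 by rewrite scale0r filt0.
  rewrite /aug (@eq_ext _ _ _ _ (fun=> 0)) ?(extEw _ (fsubset_refl _)).
    by rewrite big1 // => k _; rewrite scaler0.
  move=> t /(filtP _ _ _ Fc)[st _]; rewrite /aug_gen.
  by case: eqP => // st1; move: st n0; rewrite st1; lia.
move: in0; rewrite n0 eqxx orbF => i0; case: (ltP i 0) => ilt.
  by rewrite (filt_lt0 ilt Fc) linear0 scale0r filt0.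
by apply: filt_pt; lia.
Qed.

Lemma contractible_mpss : bigraded_iso (mpss R G r) (trivial_bigraded R).
Proof.
suff H i j : exists f : {linear mpss R G r i j -> trivial_bigraded R i j},
    bijective f.
  by exists (fun i j => sval (cid (H i j))) => i j; case: cid.
rewrite /trivial_bigraded; case: ifP => ij0; last first.
  have q0 : forall q : mpss R G r i j, q = 0.
    by apply/subquot_eq0/cyc_sub_bnd_off0; move: ij0; lia.
  exists \0; exists (fun=> 0) => [q|v]; first by rewrite [RHS]q0.
  by apply/matrixP => ? [].
case/andP: ij0 => /eqP i0 /eqP j0.
(* In bidegree (0, 0) the denominator consists of boundaries, as F_{-1} is 0, so the augmentation
   descends to the page. *)
have aug0 (c : RC) : c \in cyc r%:Z i (i + j) -> c \in bnd r%:Z i (i + j) ->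
    aug c = 0.
  move=> _ /bndP [c1 [c2 [/cycP [F1 _] _ ->]]].
  rewrite linearD /= (aug_bd connG) addr0 (filt_lt0 _ F1) ?linear0 //.
  by rewrite i0.
have [f fE] := subquot_lift (phi := @aug R G) aug0.
have pt_cyc (a : R) : a *: tup R [:: x] \in cyc r%:Z i (i + j).
  apply/cycP; rewrite bd_pt filt0; split => //.
  by rewrite i0 j0; apply: filt_pt.
exists f.
(* The inverse sends a to the class of a times the point; [c] differs from its image by a chain of
   augmentation 0, which lies in the denominator. *)
exists (fun a => \pi_(subquot _ _) (Sub (a *: tup R [:: x]) (pt_cyc a))).
  elim/quotW=> c; rewrite fE; apply/eqP; rewrite subquot_piE SubK.
  have [_ cycZD] := cyc_closed R G r%:Z i (i + j).
  apply: cyc_sub_bnd.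
    by rewrite addrC -scaleN1r; apply: cycZD; [exact: valP | exact: pt_cyc].
  rewrite linearB linearZ /= aug_tup [_ *: 1]mulr1 subrr scale0r.
  exact: filt0.
by move=> a; rewrite fE SubK linearZ /= aug_tup [_ *: 1]mulr1.
Qed.

End Contraction.

(** * Boundaries in low degrees *)

Lemma bd_tup2 (R : comNzRingType) (G : digraph) (x y : G) :
  is_gen [:: x; y] -> bd (tup R [:: x; y]) = tup R [:: y] - tup R [:: x].
Proof.
move=> g; rewrite bd_tup // !big_ord_recl big_ord0 /= exprS expr0 mulN1r.
by rewrite scaleN1r scale1r addr0.
Qed.

Lemma bd_tup3 (R : comNzRingType) (G : digraph) (x y z : G) :
  is_gen [:: x; y; z] ->
  bd (tup R [:: x; y; z]) = tup R [:: y; z] - tup R [:: x; z] + tup R [:: x; y].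
Proof.
move=> g; rewrite bd_tup // !big_ord_recl big_ord0 /=.
rewrite !exprS expr0 !mulN1r opprK.
by rewrite scaleN1r !scale1r addr0 !addrA.
Qed.

Lemma bd_tup4 (R : comNzRingType) (G : digraph) (x y z u : G) :
  is_gen [:: x; y; z; u] ->
  bd (tup R [:: x; y; z; u]) =
    tup R [:: y; z; u] - tup R [:: x; z; u] + tup R [:: x; y; u]
      - tup R [:: x; y; z].
Proof.
move=> g; rewrite bd_tup // !big_ord_recl big_ord0 /=.
rewrite !exprS expr0 !mulN1r opprK.
by rewrite !scaleN1r !scale1r addr0 !addrA.
Qed.

(** * Distances in the directed cycle on n + 1 vertices *)

Section DirectedCycle.
Variables (R : comNzRingType) (n : nat).
Local Notation Z := (dcycle n.+1).
Implicit Types x y z : Z.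

Definition cdist x y : nat :=
  if (val x <= val y)%N then (val y - val x)%N else (n.+1 + val y - val x)%N.

Lemma dpath_last x p :
  path (@edge Z) x p -> val (last x p) = ((val x + size p) %% n.+1)%N.
Proof.
elim: p x => [|y p IH] x /=; first by rewrite addn0 modn_small.
case/andP=> /andP[_ /eqP ->] /IH ->.
by rewrite /= modnDml addSnnS.
Qed.

Lemma dpath_iter x k : (0 < n)%N -> dpath x (iter k (@ordS n.+1) x : Z) k.
Proof.
move=> n0; elim: k x => [|k IH] x; first by exists [::].
have [p [sp pp lp]] := IH (ordS x); exists (ordS x :: p); split=> /=.
- by rewrite sp.
- by rewrite eqxx pp !andbT.
- by rewrite lp -iterSr.
Qed.

Lemma val_iter_ordS k x :
  val (iter k (@ordS n.+1) x : Z) = ((val x + k) %% n.+1)%N.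
Proof.
elim: k => [|k IH] /=; first by rewrite addn0 modn_small.
by rewrite [nat_of_ord _]IH -addn1 modnDml addn1 addnS.
Qed.

Lemma cdist_lt x y : (cdist x y <= n)%N.
Proof.
rewrite /cdist; have := ltn_ord x; have := ltn_ord y; rewrite /=.
by case: ifP; lia.
Qed.

Lemma cdistxx x : cdist x x = 0%N.
Proof. by rewrite /cdist leqnn subnn. Qed.

Lemma cdist_gt0 x y : x != y -> (0 < cdist x y)%N.
Proof.
rewrite -val_eqE /cdist /=; have := ltn_ord x; have := ltn_ord y.
by case: ifP; lia.
Qed.

Lemma cdist0 x : cdist (ord0 : Z) x = x.
Proof. by rewrite /cdist /= subn0. Qed.

Lemma cdist_ordS x : (0 < n)%N -> cdist x (ordS x : 'I_n.+1) = 1%N.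
Proof.
move=> n0; rewrite /cdist /=; have := ltn_ord x; rewrite leq_eqVlt eqSS ltnS.
case/predU1P=> [xn|xn]; first by rewrite xn modnn leqn0; case: eqP; lia.
by rewrite modn_small ?ltnS // leqnSn subSnn.
Qed.

Lemma neq_ordS x : (0 < n)%N -> x != (ordS x : 'I_n.+1).
Proof.
by move=> /(cdist_ordS x); apply: contra_eq_neq => <-; rewrite cdistxx.
Qed.

(** Going from x to z via y makes at most one full turn more than the shortest path; this carry is
    the winding number used below. *)
Lemma cdist_triangle x y z :
  (cdist x y + cdist y z =
     cdist x z + (n.+1 <= cdist x y + cdist y z) * n.+1)%N.
Proof.
rewrite /cdist /=.
have := ltn_ord x; have := ltn_ord y; have := ltn_ord z.
by case: ifP => ?; case: ifP => ?; case: ifP => ?; case: leqP; lia.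
Qed.

Lemma cdist_sym x y : x != y -> (cdist x y + cdist y x = n.+1)%N.
Proof.
move=> xy; have := cdist_gt0 xy; have := cdist_triangle x y x.
have := cdist_lt x y; have := cdist_lt y x; rewrite cdistxx.
by case: leqP; lia.
Qed.

Lemma cdistP x y : ((val x + cdist x y) %% n.+1)%N = val y.
Proof.
rewrite /cdist; have := ltn_ord x; have := ltn_ord y; rewrite /= => ly lx.
case: ifP => xy; first by rewrite subnKC ?modn_small.
by rewrite subnKC ?modnDl ?modn_small //; lia.
Qed.

(** A path with k edges from x to y forces y = x + k modulo n + 1, and the only such k below n + 1
    is the least one. *)
Lemma dist_dcycle x y : dist x y = Some (cdist x y).
Proof.
have dxy : dpath x y (cdist x y).
  have [n0|n0] := posnP n.
    have <- : x = y.
      by apply: val_inj => /=; have := ltn_ord x; have := ltn_ord y; lia.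
    by exists [::]; rewrite /cdist leqnn subnn.
  have e : iter (cdist x y) (@ordS n.+1) x = y.
    by apply: val_inj; rewrite val_iter_ordS cdistP.
  by rewrite -[X in dpath _ X _]e; exact: dpath_iter.
rewrite /dist; case: pselect => [ex|[]]; last first.
  by exists (cdist x y); apply/asboolP.
congr Some; case: ex_minnP => k /asboolP [p [sp pp lp]] kmin.
apply/eqP; rewrite eqn_leq kmin; last exact/asboolP.
have := dpath_last pp; rewrite lp sp => ky.
rewrite leqNgt; apply/negP => klt.
have /eqP : (val x + cdist x y = val x + k %[mod n.+1])%N by rewrite cdistP -ky.
by rewrite eqn_modDl !modn_small ?(gtn_eqF klt) //; have := cdist_lt x y; lia.
Qed.

Lemma step_dcycle x y : step x y = (x != y).
Proof. by rewrite /step dist_dcycle andbT. Qed.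

Lemma len_dcycle (x : Z) s : len (x :: s) = sumn (pairmap cdist x s).
Proof.
congr sumn; elim: s x => //= y s IH x; by rewrite dist_dcycle IH.
Qed.

(** * Trivial pages, long triples and winding *)

Lemma mpss_dcycle_trivial r : (n.+1 <= r)%N ->
  bigraded_iso (mpss R Z r) (trivial_bigraded R).
Proof.
move=> nr; apply: (@contractible_mpss _ _ _ (ord0 : Z) step_dcycle) => y.
by rewrite dist_dcycle /=; apply: leq_trans nr; exact: cdist_lt.
Qed.

(** The map [h] moves every chain of F_N into F_{N-1} up to the boundary of a chain still in F_N. *)
Lemma mpss_long_triple_vanishes r N : (0 < r)%N -> (n.+1 < N)%N ->
  vanishes (mpss R Z r) N%:Z (2 - N%:Z).
Proof.
move=> r0 nN; apply: subquot_eq0.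
have -> : N%:Z + (2 - N%:Z) = 2 by lia.
(* As N > n + 1, a triple of length N wraps around, so d(x, z) = N - (n + 1) and (x, y, x, z) again
   has length n + 1 + d(x, z) = N. *)
pose h_tup (s : seq Z) : {malg R[gen Z]} :=
  if s is [:: x; y; z] then
    if (len s == N)%N then tup R [:: x; y; x; z] else 0
  else 0.
pose h := ext (fun t : gen Z => h_tup (val t)).
have gs3 (x y z : Z) : is_gen [:: x; y; z] -> x != y /\ y != z.
  by rewrite !(is_gen_cons step_dcycle) => /and3P[].
have Fh c : c \in filt N%:Z 2 ->
    c - bd (h c) \in filt (N%:Z - 1) 2 /\ h c \in filt N%:Z 3.
  move=> /filtP Fc; split; last first.
    apply: filt_ext => -[s gs] /Fc /= [ss ls].
    case: s gs ss ls => [|x [|y [|z [|]]]] //= gs _ _.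
    case: ifP => [/eqP lN|_]; last exact: filt0.
    apply: filt_tup => // _.
    move: lN; rewrite !len_dcycle /= !dist_dcycle /= => lN.
    have := cdist_triangle x y z; have := cdist_sym (gs3 _ _ _ gs).1.
    by have := cdist_lt x z; case: leqP; lia.
  have -> : c - bd (h c) = ext (fun t => << t >> - bd (h_tup (val t))) c.
    rewrite [RHS](extEw _ (fsubset_refl _)) /h (extEw _ (fsubset_refl _)).
    rewrite linear_sum -{1}(ext_basis c) (extEw _ (fsubset_refl _)) -sumrB.
    by apply: eq_bigr => t _; rewrite linearZ scalerBr.
  apply: filt_ext => t /Fc []; rewrite -tup_val; move: (val t) (valP t).
  move=> [|x [|y [|z [|]]]] //= gs _; rewrite !dist_dcycle /= => ls.
  have [lN|lN] := eqP; last first.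
    rewrite linear0 subr0; apply: filt_tup => //=.
    by rewrite !dist_dcycle /=; lia.
  have [nxy nyz] := gs3 _ _ _ gs.
  have nyx : y != x by rewrite eq_sym.
  have nxz : x != z.
    apply/eqP => xz; move: lN; rewrite -xz.
    by have := cdist_sym nxy; lia.
  (* Besides (x, y, z), which cancels, and the degenerate (x, x, z), the faces are (x, y, x) of
     length n + 1 and (y, x, z) of length N - d(x, y), both shorter than N. *)
  rewrite bd_tup4; last by rewrite !(is_gen_cons step_dcycle) nxy nyx nxz.
  rewrite (@tup0 _ _ [:: x; x; z]) ?(is_gen_cons step_dcycle) ?eqxx // subr0.
  have -> (a b d : {malg R[gen Z]}) : a - (b + a - d) = d - b.
    by rewrite opprB addrCA opprD [a + (_ - a)]addrCA subrr addr0.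
  apply: filtB; apply: filt_tup => // _; rewrite len_dcycle /=.
    by have := cdist_sym nxy; lia.
  have := cdist_gt0 nxy; have := cdist_sym nxy; have := cdist_triangle x y z.
  by have := cdist_lt x z; case: leqP; lia.
move=> c /cycP [Fc Fdc]; have [F1 F2] := Fh c Fc.
apply/bndP; exists (c - bd (h c)), (h c); split; last by rewrite subrK.
  apply/cycP; split=> //; rewrite linearB /= (bd_bd step_dcycle) subr0.
  by have -> : N%:Z - 1 - (r%:Z - 1) = N%:Z - r%:Z by lia.
apply/cycP; split; first by apply: filtS F2; lia.
have -> : N%:Z + r%:Z - 1 - (r%:Z - 1) = N%:Z by lia.
have -> : bd (h c) = c - (c - bd (h c)) by rewrite subKr.
by apply: filtB => //; apply: filtS F1; lia.
Qed.

(* The cochain counting how often a triple winds around the cycle; n + 1 times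
   it is the coboundary of the distance, hence it is a cocycle. *)
Definition winding (s : seq Z) : R^o :=
  if s is [:: x; y; z] then (n.+1 <= cdist x y + cdist y z)%N%:R else 0.

Definition wind := ext (fun t : gen Z => winding (val t)).
HB.instance Definition _ := GRing.Linear.on wind.

(** Degenerate triples do not wind, one step being 0 and the other at most n, so the formula holds
    for every tuple. *)
Lemma wind_tup s : wind (tup R s) = winding s.
Proof.
rewrite /wind ext_tup; case: ifPn => //.
case: s => [|x [|y [|z [|]]]] //=; rewrite !(is_gen_cons step_dcycle) andbT.
rewrite negb_and !negbK => /orP [] /eqP ->; rewrite cdistxx ?addn0;
  by rewrite leqNgt ltnS cdist_lt.
Qed.

(** Times n + 1, the winding number of (x, y, z) is d(x, y) + d(y, z) - d(x, z), and these sums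
    cancel over the four faces. *)
Lemma wind_bd i (c : {malg R[gen Z]}) : c \in filt i 3 -> wind (bd c) = 0.
Proof.
move=> /filtP Fc.
apply: (linear_eq (phi := wind \o @bd R Z) (psi := \0)) => t /Fc [st _] /=.
rewrite -tup_val; move: (val t) (valP t) st => [|x [|y [|z [|u [|]]]]] //= gs _.
rewrite bd_tup4 // !linearD !linearN /= !wind_tup /winding.
rewrite -[_ - _ + _ - _]addrA addrACA -opprD -!natrD.
set k1 := (_ + _)%N; set k2 := (_ + _)%N.
have -> : k1 = k2; last by rewrite subrr.
(* The factor n + 1 is cancelled in the natural numbers, since it may be zero in [R]. *)
apply/eqP; rewrite -(eqn_pmul2r (ltn0Sn n)) /k1 /k2 !mulnDl.
have := cdist_triangle x y z; have := cdist_triangle x y u.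
have := cdist_triangle x z u; have := cdist_triangle y z u.
by lia.
Qed.

Lemma wind_filt (c : {malg R[gen Z]}) : c \in filt n%:Z 2 -> wind c = 0.
Proof.
move=> /filtP Fc.
apply: (linear_eq (phi := wind) (psi := \0)) => t /Fc [].
rewrite -tup_val; move: (val t) (valP t) => [|x [|y [|z [|]]]] //= gs _.
rewrite wind_tup /= !dist_dcycle /= => ls.
by have -> : (n < cdist x y + cdist y z)%N = false by lia.
Qed.

Lemma cone_cycle_survives r : (0 < n)%N -> (r <= n)%N ->
  ~ vanishes (mpss R Z r) n.+1%:Z (2 - n.+1%:Z).
Proof.
move=> n0 rn; pose z := \sum_(y : 'I_n.+1) tup R [:: (y : Z); ordS y].
have bdz : bd z = 0.
  pose F (y : 'I_n.+1) := tup R [:: (ordS y : Z)] - tup R [:: (y : Z)].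
  rewrite linear_sum /= (eq_bigr F).
    by rewrite sumrB [X in _ - X](reindex_inj (@ordS_inj n.+1)) subrr.
  by move=> y _; rewrite bd_tup2 // (is_gen_cons step_dcycle) neq_ordS.
have Fz : z \in filt (n.+1%:Z - r%:Z) 1.
  rewrite /z; elim/big_rec: _ => [|y c _ Fc]; first exact: filt0.
  apply: filtD => //; apply: filt_tup => // _.
  by rewrite len_dcycle /= cdist_ordS //; lia.
have augz : aug z = 0.
  by rewrite /z linear_sum /= big1 // => y _; rewrite aug_tup.
have dc : bd (cone (ord0 : Z) z) = z.
  by rewrite (bd_cone step_dcycle) bdz augz linear0 scale0r !subr0.
have Zc : cone (ord0 : Z) z \in cyc r%:Z n.+1%:Z 2.
  apply/cycP; rewrite dc; split=> //.
  rewrite linear_sum /=; elim/big_rec: _ => [|y c _ Fc]; first exact: filt0.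
  apply: filtD => //; rewrite (cone_tup R step_dcycle) //.
  apply: filt_tup => // _.
  by rewrite len_dcycle /= cdist0 cdist_ordS //; have := ltn_ord y; lia.
have Bc : cone (ord0 : Z) z \notin bnd r%:Z n.+1%:Z 2.
  apply/negP => /bndP [c1 [c2 [/cycP [F1 _] /cycP [F2 _] e]]].
  (* [c1] lies in F_n, where no triple winds, and [bd c2] is a boundary. *)
  have : wind (cone (ord0 : Z) z) = 0.
    rewrite e linearD /= wind_filt ?(wind_bd F2) ?addr0 //.
    by apply: filtS F1; lia.
  (* Among the triples (0, y, y + 1) only (0, n, 0) winds around. *)
  have -> : wind (cone (ord0 : Z) z) = \sum_(y : 'I_n.+1) (y == ord_max)%:R.
    rewrite (linear_sum (cone (ord0 : Z))) (linear_sum wind).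
    apply: eq_bigr => y _ /=; rewrite (cone_tup R step_dcycle) // wind_tup /=.
    rewrite cdist0 cdist_ordS // addn1 ltnS -val_eqE /=; congr _%:R.
    by have := ltn_ord y; lia.
  rewrite (bigD1 (ord_max : 'I_n.+1)) //= eqxx big1; last by move=> y /negPf ->.
  by rewrite addr0; apply/eqP/oner_neq0.
move=> V; have e2 : n.+1%:Z + (2 - n.+1%:Z) = 2 by lia.
rewrite -e2 in Zc Bc.
have [q []] := subquot_neq0 Zc Bc; exact: V.
Qed.

(** * Pairs on the page r = 0 *)

Lemma mpss0_pair_survives : (0 < n)%N ->
  ~ vanishes (mpss R Z 0) n%:Z (1 - n%:Z).
Proof.
move=> n0; pose s := [:: (ord0 : Z); (ord_max : Z)].
have gs : is_gen s.
  by rewrite (is_gen_cons step_dcycle) andbT -val_eqE /= eq_sym -lt0n.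
have Fs : tup R s \in filt n%:Z 1.
  by apply: filt_tup => // _; rewrite len_dcycle /= cdist0 /= addn0.
have Zs : tup R s \in cyc 0%:Z n%:Z 1.
  apply/cycP; split=> //; rewrite bd_tup2 //.
  by apply: filtB; apply: filt_tup => // _; rewrite len_dcycle /=; lia.
have Bs : tup R s \notin bnd 0%:Z n%:Z 1.
  apply/negP => /bndP [c1 [c2 [/cycP [F1 _] /cycP [F2 _] e]]].
  (* At r = 0 the denominator lies in F_{n-1}, as no face is longer than its triple by the triangle
     inequality; but (0, n) has length n. *)
  have : tup R s \in filt (n%:Z - 1) 1.
    rewrite e; apply: filtD => //; move/filtP: F2 => F2.
    rewrite /bd; apply: filt_ext => t /F2 [].
    rewrite -[bd_gen R t]extU -/(bd _).
    rewrite -tup_val; move: (val t) (valP t) => [|x [|y [|z [|]]]] //= gt _.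
    rewrite bd_tup3 // !dist_dcycle /= => ls.
    apply: filtD; [apply: filtB|]; apply: filt_tup => // _;
      rewrite len_dcycle /=; [lia| |lia].
    by have := cdist_triangle x y z; case: leqP; lia.
  have /= ss : (Sub s gs : gen Z) \in msupp (tup R s).
    rewrite -[X in tup R X]/(val (Sub s gs : gen Z)) tup_val.
    by rewrite -mcoeff_neq0 mcoeffUU oner_neq0.
  move/filtP => /(_ _ ss) [_]; rewrite len_dcycle /= cdist0 /=; lia.
move=> V; have e1 : n%:Z + (1 - n%:Z) = 1 by lia.
rewrite -e1 in Zs Bs.
have [q []] := subquot_neq0 Zs Bs; exact: V.
Qed.

Lemma mpss0_long_pair_vanishes N : (n < N)%N ->
  vanishes (mpss R Z 0) N%:Z (1 - N%:Z).
Proof.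
move=> nN; apply: subquot_eq0; have -> : N%:Z + (1 - N%:Z) = 1 by lia.
move=> c /cycP [/filtP Fc]; rewrite subr0 => Fdc.
apply/bndP; exists c, 0; split; last by rewrite linear0 addr0.
  (* Here r - 1 = -1, so the boundary only has to lie in F_N. *)
  apply/cycP; split; last by rewrite sub0r opprK subrK.
  apply/filtP => t /Fc [] st ls; split=> //; move: st ls.
  case: (val t) => [|x [|y [|]]] //= _ _; rewrite dist_dcycle /= addn0.
  by have := cdist_lt x y; lia.
by apply/cycP; rewrite linear0 !filt0.
Qed.

End DirectedCycle.

(** * Separation of the cycles *)

(** The second index 2 - n serves both cases: the total degree is 1 for r = 0, where pairs are
    compared, and 2 otherwise, for triples. *)
Lemma mpss_dcycle_separated (R : comNzRingType) r m n :
    (0 < m)%N -> (r <= m)%N -> (m < n)%N ->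
  let i := if r is 0 then n%:Z - 1 else n%:Z in
  vanishes (mpss R (dcycle m) r) i (2 - n%:Z) /\
  ~ vanishes (mpss R (dcycle n) r) i (2 - n%:Z).
Proof.
case: m n => [|m] [|n] // _ rm mn; case: r rm => [|r] rm /=.
  have -> : n.+1%:Z - 1 = n%:Z by lia.
  have -> : 2 - n.+1%:Z = 1 - n%:Z by lia.
  by split; [apply: mpss0_long_pair_vanishes | apply: mpss0_pair_survives]; lia.
by split; [apply: mpss_long_triple_vanishes | apply: cone_cycle_survives]; lia.
Qed.

Theorem corollary8p3 (R : comNzRingType) :
  (forall r m n : nat, (1 <= m)%N -> (1 <= n)%N -> (r <= m)%N -> (r <= n)%N ->
     m <> n ->
     ~ bigraded_iso (mpss R (dcycle m) r) (mpss R (dcycle n) r)) /\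
  (forall r m : nat, (1 <= m)%N -> (m <= r)%N ->
     bigraded_iso (mpss R (dcycle m) r) (trivial_bigraded R)) /\
  (forall m n : nat, (2 <= m)%N -> (2 <= n)%N -> m <> n ->
     ~ bigraded_iso (PH R (dcycle m)) (PH R (dcycle n))).
Proof.
split; [|split].
- move=> r m n m0 n0 rm rn mn iso.
  have [lt|lt|//] := ltngtP m n.
    have [V W] := mpss_dcycle_separated R m0 rm lt.
    by apply: W; apply/(bigraded_iso_vanishes _ _ iso).
  have [V W] := mpss_dcycle_separated R n0 rn lt.
  by apply: W; apply/(bigraded_iso_vanishes _ _ iso).
- by move=> r [|m] // _ mr; apply: mpss_dcycle_trivial.
- move=> m n m2 n2 mn iso.
  have [lt|lt|//] := ltngtP m n.
    have [V W] := mpss_dcycle_separated R (ltnW m2) m2 lt.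
    (* [PH] at k = 2 and l = n is the entry of E^2 at (n, 2 - n), the bidegree that separates the
       cycles. *)
    by apply: W; apply/(bigraded_iso_vanishes 2 n%:Z iso).
  have [V W] := mpss_dcycle_separated R (ltnW n2) n2 lt.
  by apply: W; apply/(bigraded_iso_vanishes 2 m%:Z iso).
Qed.
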